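(* Let $F$ be a number field Galois over $\mathbb Q$, $M$ an even integer divisible by the discriminant of $F$, let $\sigma_1=\mathrm{id},\sigma_2\in\mathrm{Gal}(F/\mathbb Q)$ (a vertical gauge with $n=2$), $p$ a prime not dividing $M$, $\mathfrak P$ a prime of $\mathcal O_F$ dividing $p$, and let $q=d\cdot1_2$ with $d\in\mathcal O_F[1/M]^\times$. Assume $q$ is vertical gauge invariant, i.e. $\sigma_2(d)=d$. Let $(\varphi_{ij})$ be the curvature of the vertical Levi-Civita connection attached to $q$ at $\mathfrak P$, and let $\Phi_{12}=\varphi_{12}(x)$. Then, with $\delta=\delta^1$, one has in $\mathcal O(\widehat{G^1})$ $$\Phi_{12}\equiv\begin{pmatrix}0&\left(\frac{\delta d}{d^p}\right)^p\\-\left(\frac{\delta d}{d^p}\right)^p&0\end{pmatrix}\quad\text{mod }(p,x-1),$$ where $(p,x-1)$ is the ideal generated by $p,\ x_{11}-1,\ x_{22}-1,\ x_{12},\ x_{21}$.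
   Context: Below $n=2$. For a matrix $a=(a_{ij})$, $a^t$ is the transpose and $a^{(p)}=(a_{ij}^p)$; set maps between rings are applied to matrices entrywise. A Frobenius lift on a ring $A$ is a ring endomorphism reducing mod $p$ to the $p$-power Frobenius of $A/pA$. On a $p$-torsion free ring a $p$-derivation $\delta$ is the same as a Frobenius lift $\phi$, via $\phi(a)=a^p+p\,\delta a$ (''attached''). $\widehat{\ }$ denotes $p$-adic completion. Set $\mathfrak P_i=\sigma_i\mathfrak P$ and let $R_i=\widehat{\mathcal O_{\mathfrak P_i}}$ be the $p$-adic completion of the localization of $\mathcal O_F$ at $\mathfrak P_i$ (a complete discrete valuation ring with maximal ideal generated by the odd prime $p$). It has a unique Frobenius lift $\phi^i$, hence a unique $p$-derivation $\delta^i$. Let $x$ be an $n\times n$ matrix of indeterminates, $G^i=\mathrm{Spec}\,R_i[x,\det(x)^{-1}]$, $\mathcal O(\widehat{G^i})=R_i[x,\det(x)^{-1}]^{\widehat{\ }}$. The automorphism $\sigma_i$ induces an isomorphism $R_1\to R_i$, extended to $\sigma_i:\mathcal O(\widehat{G^1})\to\mathcal O(\widehat{G^i})$ by $\sigma_i(x)=x$. A vertical connection at $\mathfrak P$ is an $n$-tuple $(\delta^1,\dots,\delta^n)$ where $\delta^i$ is a $p$-derivation on $\mathcal O(\widehat{G^i})$ extending that of $R_i$ (same notation), with attached Frobenius lift $\phi^i$. It is metric with respect to $q$ if for every $i$, $\phi^i\circ\mathcal H_q=\mathcal H_q\circ\phi^i_0$, where $\mathcal H_q$ is the (continuous) $R_i$-algebra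 endomorphism of $\mathcal O(\widehat{G^i})$ with $x\mapsto x^tqx$ and $\phi_0^i$ is the Frobenius lift extending that of $R_i$ with $\phi_0^i(x)=x^{(p)}$. With $\gamma_i=(\gamma_{ijk})_{j,k}:=(\delta^ix)^t\cdot\phi^i(q)\cdot x^{(p)}$, it is torsion free relative to $q$ if $\sigma_i^{-1}\gamma_{ijk}=\sigma_j^{-1}\gamma_{jik}$ for all $i,j,k$. The vertical Levi-Civita connection attached to $q$ at $\mathfrak P$ is the unique (it exists) vertical connection that is metric with respect to $q$ and torsion free relative to $q$. Its curvature is the family of additive maps $\varphi_{ij}:\mathcal O(\widehat{G^1})\to\mathcal O(\widehat{G^1})$, $$\varphi_{ij}=\frac1p\{\sigma_i^{-1}\phi^i\sigma_i\sigma_j^{-1}\phi^j\sigma_j-\sigma_j^{-1}\phi^j\sigma_j\sigma_i^{-1}\phi^i\sigma_i\}$$ (composition of maps, rightmost first). *)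

(* Defs.v *)
From HB Require Import structures.
From mathcomp Require Import all_boot all_order all_fingroup all_algebra all_field.
From mathcomp Require Import generic_quotient ring_quotient.
From mathcomp Require Import boolp.
From mathcomp Require Import mpoly.

Set Implicit Arguments.
Unset Strict Implicit.
Unset Printing Implicit Defensive.

Import GRing.Theory.
Local Open Scope ring_scope.
Local Open Scope quotient_scope.

(* ring_quotient only treats proper ideals of nontrivial rings; the quotients  *)
(* A / p^0 A = 0 in an inverse limit make us work with comPzRingType.          *)
Section QuotientRing.
Variables (A : comPzRingType) (s : seq A).

Definition gen_ideal : {pred A} :=
  [pred a | `[< exists c : nat -> A, a = \sum_(i < size s) c i * s`_i >]].

Lemma gen_idealP a :
  reflect (exists c : nat -> A, a = \sum_(i < size s) c i * s`_i)
          (a \in gen_ideal).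
Proof. exact: asboolP. Qed.

Lemma gen_ideal_zmod_closed : zmod_closed gen_ideal.
Proof.
split=> [|a b /gen_idealP[c ->] /gen_idealP[c' ->]]; apply/gen_idealP.
  by exists (fun=> 0); rewrite big1 // => i _; rewrite mul0r.
exists (fun i => c i - c' i); rewrite -sumrB.
by apply: eq_bigr => i _; rewrite mulrBl.
Qed.

HB.instance Definition _ := GRing.isZmodClosed.Build A gen_ideal
  gen_ideal_zmod_closed.

Lemma gen_idealMr a b : b \in gen_ideal -> a * b \in gen_ideal.
Proof.
move=> /gen_idealP[c ->]; apply/gen_idealP; exists (fun i => a * c i).
by rewrite mulr_sumr; apply: eq_bigr => i _; rewrite mulrA.
Qed.

Definition quot_ring := Quotient.quot gen_ideal.

HB.instance Definition _ := GRing.Zmodule.on quot_ring.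
HB.instance Definition _ := EqQuotient.on quot_ring.

Lemma quot_ringE (a b : A) :
  (\pi_quot_ring a == \pi_quot_ring b) = (a - b \in gen_ideal).
Proof. by rewrite piE Quotient.equivE. Qed.

Definition quot_pi (a : A) : quot_ring := \pi_quot_ring a.
Definition quot_repr (u : quot_ring) : A := repr u.

Lemma quot_reprK u : quot_pi (quot_repr u) = u.
Proof. exact: reprK. Qed.

Lemma quot_piE a b : quot_pi a = quot_pi b <-> a - b \in gen_ideal.
Proof. by rewrite -quot_ringE; split=> [ab|/eqP//]; apply/eqP. Qed.

Fact quot_pi_zmod_morphism : zmod_morphism quot_pi.
Proof. by move=> a b; rewrite /quot_pi !piE. Qed.

HB.instance Definition _ := GRing.isZmodMorphism.Build A quot_ring quot_pi
  quot_pi_zmod_morphism.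

Definition quot_one : quot_ring := quot_pi 1.
Definition quot_mul (u v : quot_ring) : quot_ring :=
  quot_pi (quot_repr u * quot_repr v).

Lemma quot_pi_mul (a b : A) : quot_mul (quot_pi a) (quot_pi b) = quot_pi (a * b).
Proof.
have repr_sub (c : A) : quot_repr (quot_pi c) - c \in gen_ideal.
  by apply/quot_piE/quot_reprK.
apply/quot_piE; set a' := quot_repr _; set b' := quot_repr _.
rewrite -[a' * b'](subrK (a' * b)) -mulrBr -addrA -mulrBl rpredD //.
  by apply: gen_idealMr; apply: repr_sub.
by rewrite mulrC; apply: gen_idealMr; apply: repr_sub.
Qed.

Fact quot_mulA : associative quot_mul.
Proof.
move=> u v w; rewrite -[u]quot_reprK -[v]quot_reprK -[w]quot_reprK.
by rewrite !quot_pi_mul mulrA.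
Qed.

Fact quot_mulC : commutative quot_mul.
Proof. by move=> u v; rewrite /quot_mul mulrC. Qed.

Fact quot_mul1 : left_id quot_one quot_mul.
Proof. by move=> u; rewrite -[u]quot_reprK /quot_one quot_pi_mul mul1r. Qed.

Fact quot_mulDl : left_distributive quot_mul +%R.
Proof.
move=> u v w; rewrite -[u]quot_reprK -[v]quot_reprK -[w]quot_reprK.
by rewrite !quot_pi_mul -2!(raddfD quot_pi) quot_pi_mul mulrDl.
Qed.

HB.instance Definition _ := GRing.Zmodule_isComPzRing.Build quot_ring
  quot_mulA quot_mulC quot_mul1 quot_mulDl.

Fact quot_pi_monoid_morphism : monoid_morphism quot_pi.
Proof. by split=> // a b; rewrite -quot_pi_mul. Qed.

HB.instance Definition _ := GRing.isMonoidMorphism.Build A quot_ring quot_pi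
  quot_pi_monoid_morphism.

End QuotientRing.

(* The p-adic completion, as the inverse limit of the rings A / p^n A. *)
Section Completion.
Variables (p : nat) (A : comPzRingType).

Definition quo_pow n := quot_ring [:: p%:R ^+ n : A].

HB.instance Definition _ n := GRing.ComPzRing.on (quo_pow n).

Definition quo_pow_trans n (u : quo_pow n.+1) : quo_pow n := quot_pi _ (quot_repr u).

Lemma quo_pow_transE n a :
  quo_pow_trans (quot_pi [:: p%:R ^+ n.+1] a) = quot_pi [:: p%:R ^+ n] a.
Proof.
apply/quot_piE; have : quot_repr (quot_pi [:: p%:R ^+ n.+1] a) - a
    \in gen_ideal [:: p%:R ^+ n.+1 : A].
  by apply/quot_piE/quot_reprK.
move=> /gen_idealP[c ->]; rewrite big_ord1 /= exprS mulrA.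
by apply: gen_idealMr; apply/gen_idealP; exists (fun=> 1); rewrite big_ord1 mul1r.
Qed.

Fact quo_pow_trans_zmod n : zmod_morphism (@quo_pow_trans n).
Proof.
move=> u v; rewrite -[u]quot_reprK -[v]quot_reprK -rmorphB.
by rewrite !quo_pow_transE rmorphB.
Qed.

Fact quo_pow_trans_monoid n : monoid_morphism (@quo_pow_trans n).
Proof.
split=> [|u v]; first by rewrite -[1](rmorph1 (quot_pi _)) quo_pow_transE rmorph1.
rewrite -[u]quot_reprK -[v]quot_reprK -rmorphM.
by rewrite !quo_pow_transE rmorphM.
Qed.

HB.instance Definition _ n := GRing.isZmodMorphism.Build
  (quo_pow n.+1) (quo_pow n) (@quo_pow_trans n) (@quo_pow_trans_zmod n).
HB.instance Definition _ n := GRing.isMonoidMorphism.Build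
  (quo_pow n.+1) (quo_pow n) (@quo_pow_trans n) (@quo_pow_trans_monoid n).

Record completion := Completion {
  coord n : quo_pow n;
  coordP n : quo_pow_trans (coord n.+1) = coord n }.

HB.instance Definition _ := gen_eqMixin completion.
HB.instance Definition _ := gen_choiceMixin completion.

Lemma completion_eq (f g : completion) : (forall n, coord f n = coord g n) -> f = g.
Proof.
case: f g => [f fP] [g gP] /= fg.
have {fg} fg : f = g by apply: functional_extensionality_dep.
by subst g; congr Completion; apply: Prop_irrelevance.
Qed.

Definition compl_zero : completion.
Proof. by exists (fun=> 0) => n; rewrite rmorph0. Defined.
Definition compl_one : completion.
Proof. by exists (fun=> 1) => n; rewrite rmorph1. Defined.
Definition compl_opp (f : completion) : completion.
Proof. by exists (fun n => - coord f n) => n; rewrite rmorphN /= coordP. Defined.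
Definition compl_add (f g : completion) : completion.
Proof.
by exists (fun n => coord f n + coord g n) => n; rewrite rmorphD /= !coordP.
Defined.
Definition compl_mul (f g : completion) : completion.
Proof.
by exists (fun n => coord f n * coord g n) => n; rewrite rmorphM /= !coordP.
Defined.

Fact compl_addA : associative compl_add.
Proof. by move=> f g h; apply: completion_eq => n /=; rewrite addrA. Qed.
Fact compl_addC : commutative compl_add.
Proof. by move=> f g; apply: completion_eq => n /=; rewrite addrC. Qed.
Fact compl_add0 : left_id compl_zero compl_add.
Proof. by move=> f; apply: completion_eq => n /=; rewrite add0r. Qed.
Fact compl_addN : left_inverse compl_zero compl_opp compl_add.
Proof. by move=> f; apply: completion_eq => n /=; rewrite addNr. Qed.

HB.instance Definition _ := GRing.isZmodule.Build completion
  compl_addA compl_addC compl_add0 compl_addN.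

Fact compl_mulA : associative compl_mul.
Proof. by move=> f g h; apply: completion_eq => n /=; rewrite mulrA. Qed.
Fact compl_mulC : commutative compl_mul.
Proof. by move=> f g; apply: completion_eq => n /=; rewrite mulrC. Qed.
Fact compl_mul1 : left_id compl_one compl_mul.
Proof. by move=> f; apply: completion_eq => n /=; rewrite mul1r. Qed.
Fact compl_mulDl : left_distributive compl_mul +%R.
Proof. by move=> f g h; apply: completion_eq => n /=; rewrite mulrDl. Qed.

HB.instance Definition _ := GRing.Zmodule_isComPzRing.Build completion
  compl_mulA compl_mulC compl_mul1 compl_mulDl.

Definition to_compl (a : A) : completion :=
  @Completion (fun n => quot_pi _ a) (fun n => quo_pow_transE n a).

Fact to_compl_zmod_morphism : zmod_morphism to_compl.
Proof. by move=> a b; apply: completion_eq => n /=; rewrite rmorphB. Qed.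
Fact to_compl_monoid_morphism : monoid_morphism to_compl.
Proof.
by split=> [|a b]; apply: completion_eq => n /=; rewrite (rmorph1, rmorphM).
Qed.

HB.instance Definition _ := GRing.isZmodMorphism.Build A completion to_compl
  to_compl_zmod_morphism.
HB.instance Definition _ := GRing.isMonoidMorphism.Build A completion to_compl
  to_compl_monoid_morphism.

End Completion.

(* On a p-torsion free ring (the only case used) a p-derivation amounts to a   *)
(* Frobenius lift; attached_lift p delta is the lift attached to delta.        *)
Section PDerivations.
Variables (p : nat) (A : comPzRingType).

Definition attached_lift (delta : A -> A) (a : A) : A := a ^+ p + p%:R * delta a.

Definition p_derivation (delta : A -> A) : Prop :=
  zmod_morphism (attached_lift delta) /\ monoid_morphism (attached_lift delta).

Definition frobenius_lift (phi : {rmorphism A -> A}) : Prop :=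
  forall a, exists b, phi a = a ^+ p + p%:R * b.

End PDerivations.

Definition frob_mx (A : comPzRingType) (p m n : nat) (a : 'M[A]_(m, n)) :=
  map_mx (fun z => z ^+ p) a.

Definition mx2 (A : Type) (a b c d : A) : 'M[A]_2 :=
  \matrix_(i, j) if i == ord0 then (if j == ord0 then a else b)
                 else (if j == ord0 then c else d).

Section NumberField.
Variable F : splittingFieldType rat.

Definition ring_of_integers : {pred F} :=
  [pred z | `[< integralOver (intr : int -> F) z >]].

Definition is_discriminant (D : int) : Prop :=
  exists b : (\dim {:F}).-tuple F,
  [/\ basis_of {:F} b,
      forall z, z \in ring_of_integers <->
        exists c : 'I_(\dim {:F}) -> int, z = \sum_i (c i)%:~R * tnth b i
    & D%:~R = \det (\matrix_(i, j) galTrace 1 {:F} (tnth b i * tnth b j)) :> F].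

(* O_F[1/M] and its group of units. *)
Definition integers_inv (M : int) : {pred F} :=
  [pred z | `[< exists k, M%:~R ^+ k * z \in ring_of_integers >]].

Definition integers_inv_unit (M : int) (z : F) : Prop :=
  [/\ z != 0, z \in integers_inv M & z^-1 \in integers_inv M].

Lemma ring_of_integersP z :
  reflect (integralOver (intr : int -> F) z) (z \in ring_of_integers).
Proof. exact: asboolP. Qed.

Lemma ring_of_integers_subring : subring_closed ring_of_integers.
Proof.
split=> [|a b /ring_of_integersP ha /ring_of_integersP hb|
          a b /ring_of_integersP ha /ring_of_integersP hb];
  apply/ring_of_integersP.
- exact: integral1.
- exact: integral_sub.
- exact: integral_mul.
Qed.

HB.instance Definition _ := GRing.isSubringClosed.Build F ring_of_integers
  ring_of_integers_subring.

Lemma gal_ring_of_integers (s : gal_of {:F}) z :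
  z \in ring_of_integers -> s z \in ring_of_integers.
Proof.
move=> /ring_of_integersP[g mon_g gz]; apply/ring_of_integersP; exists g => //.
have -> : map_poly intr g = map_poly s (map_poly (intr : int -> F) g).
  by rewrite -map_poly_comp; apply: eq_map_poly => m /=; rewrite rmorph_int.
by rewrite rmorph_root.
Qed.

Section PrimesOverP.
Variable p : nat.

Record prime_over := PrimeOver {
  prime_mem :> {pred F};
  prime_int : {subset prime_mem <= ring_of_integers};
  prime0 : 0 \in prime_mem;
  primeD : {in prime_mem &, forall a b, a + b \in prime_mem};
  primeM : {in ring_of_integers & prime_mem, forall a b, a * b \in prime_mem};
  prime1 : 1 \notin prime_mem;
  prime_prime : {in ring_of_integers &, forall a b,
    a * b \in prime_mem -> (a \in prime_mem) || (b \in prime_mem)};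
  prime_over_p : p%:R \in prime_mem }.

Definition gal_image (s : gal_of {:F}) (P : prime_over) : {pred F} :=
  [pred z | s^-1%g z \in P].

Definition gal_prime (s : gal_of {:F}) (P : prime_over) : prime_over.
Proof.
apply: (@PrimeOver (gal_image s P)); rewrite ?inE.
- move=> z; rewrite inE => /prime_int /(gal_ring_of_integers s).
  by rewrite -galM ?memvf // mulVg gal_id.
- by rewrite rmorph0 prime0.
- by move=> a b; rewrite !inE rmorphD; apply: primeD.
- move=> a b aO; rewrite !inE rmorphM; apply: primeM.
  exact: gal_ring_of_integers.
- by rewrite rmorph1 prime1.
- move=> a b aO bO; rewrite !inE rmorphM.
  by apply: prime_prime; apply: gal_ring_of_integers.
- by rewrite rmorph_nat prime_over_p.
Defined.

Lemma gal_primeE s P z : (z \in gal_prime s P) = (s^-1%g z \in P).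
Proof. by []. Qed.

Section Local.
Variable P : prime_over.

Definition local_pred : {pred F} :=
  [pred z | `[< exists a b, [/\ a \in ring_of_integers, b \in ring_of_integers,
                                b \notin P & z = a / b] >]].

Lemma local_predP z :
  reflect (exists a b, [/\ a \in ring_of_integers, b \in ring_of_integers,
                           b \notin P & z = a / b]) (z \in local_pred).
Proof. exact: asboolP. Qed.

Lemma notin_prime_neq0 b : b \notin P -> b != 0.
Proof. by apply: contraNneq => ->; apply: prime0. Qed.

Lemma local_subring : subring_closed local_pred.
Proof.
split=> [|_ _ /local_predP[a [b [aO bO bP ->]]] /local_predP[c [e [cO eO eP ->]]]
         |_ _ /local_predP[a [b [aO bO bP ->]]] /local_predP[c [e [cO eO eP ->]]]];
  apply/local_predP.
- by exists 1, 1; rewrite rpred1 prime1 divr1.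
- exists (a * e - c * b), (b * e); rewrite !(rpredB, rpredM) //; split=> //.
    by apply/negP => /(prime_prime bO eO); rewrite (negbTE bP) (negbTE eP).
  by rewrite -mulNr addf_div ?notin_prime_neq0 // mulNr.
- exists (a * c), (b * e); rewrite !rpredM //; split=> //.
    by apply/negP => /(prime_prime bO eO); rewrite (negbTE bP) (negbTE eP).
  by rewrite mulf_div.
Qed.

Record local := Local { local_val : F; _ : local_val \in local_pred }.

HB.instance Definition _ := [isSub for local_val].
HB.instance Definition _ := [Choice of local by <:].
HB.instance Definition _ := GRing.SubChoice_isSubComNzRing.Build
  F local_pred local local_subring.

Lemma integers_inv_local (M : int) z : prime p -> ~~ (p %| M)%Z ->
  z \in integers_inv M -> z \in local_pred.
Proof.
move=> p_pr pM /asboolP[k MzO]; apply/local_predP.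
have MO n : M%:~R ^+ n \in ring_of_integers by rewrite rpredX ?rpred_int.
have MP n : M%:~R ^+ n \notin P.
  elim: n => [|n IHn]; first by rewrite expr0 prime1.
  apply/negP; rewrite exprS => /(prime_prime (MO 1) (MO n)).
  rewrite (negbTE IHn) orbF expr1 => MP; suff : 1 \in P by rewrite (negbTE (prime1 P)).
  have [u [v uv]] := Bezoutz M p.
  have /eqP g1 : gcdz M p == 1.
    by rewrite /gcdz eqz_nat -/(coprime _ _) coprime_sym prime_coprime.
  have -> : (1 : F) = u%:~R * M%:~R + v%:~R * p%:R.
    by rewrite pmulrn -!intrM -intrD uv g1.
  by apply: primeD; apply: primeM; rewrite ?rpred_int ?prime_over_p.
exists (M%:~R ^+ k * z), (M%:~R ^+ k); split=> //.
by rewrite mulrAC divff ?notin_prime_neq0 ?mul1r.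
Qed.

(* The element z of F seen in O_P; junk (0) when z is not in O_P, which does   *)
(* not happen for z in O_F[1/M], by the previous lemma.                        *)
Definition to_local (z : F) : local := insubd 0 z.

Definition Rhat := completion p local.

HB.instance Definition _ := GRing.ComPzRing.on Rhat.

Fact Rhat_nonzero : (1 : Rhat) != 0.
Proof.
apply/eqP => /(congr1 (fun f : Rhat => coord f 1)) /= e10.
have /quot_piE/gen_idealP[c] :
    quot_pi [:: p%:R ^+ 1] (1 : local) = quot_pi [:: p%:R ^+ 1] 0.
  by rewrite rmorph1 rmorph0.
rewrite big_ord1 /= expr1 subr0 => /(congr1 (val : local -> F)).
rewrite rmorph1 rmorphM rmorph_nat.
case: (c 0%N) => z zP /= zE; have /local_predP[a [b [aO bO bP zab]]] := zP.
case/negP: (bP); have -> : b = a * p%:R.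
  by rewrite -[LHS]mulr1 [X in b * X]zE zab mulrA mulrCA divff ?notin_prime_neq0 ?mulr1.
by apply: primeM => //; apply: prime_over_p.
Qed.

HB.instance Definition _ := GRing.PzSemiRing_isNonZero.Build Rhat Rhat_nonzero.

Definition Rhat_unit : {pred Rhat} := [pred r | `[< exists t, t * r = 1 >]].

Definition Rhat_inv (r : Rhat) : Rhat :=
  if pselect (exists t, t * r = 1) is left h then projT1 (cid h) else r.

Fact Rhat_mulVr : {in Rhat_unit, left_inverse 1 Rhat_inv *%R}.
Proof.
move=> r /asboolP hr; rewrite /Rhat_inv; case: pselect => // h.
by case: cid.
Qed.

Fact Rhat_unitP (r t : Rhat) : t * r = 1 -> r \in Rhat_unit.
Proof. by move=> tr; apply/asboolP; exists t. Qed.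

Fact Rhat_inv_out : {in [predC Rhat_unit], Rhat_inv =1 id}.
Proof. by move=> r /asboolP hr; rewrite /Rhat_inv; case: pselect. Qed.

HB.instance Definition _ := GRing.ComNzRing_hasMulInverse.Build Rhat
  Rhat_mulVr Rhat_unitP Rhat_inv_out.

Definition to_Rhat (z : F) : Rhat := to_compl p (to_local z).

(* O(G) = R[x, det(x)^-1], presented as R[x][t] / (t det(x) - 1), where R[x]   *)
(* has one variable per entry of a 2 x 2 matrix.                               *)
Definition poly_mx : 'M[{mpoly Rhat[2 * 2]}]_2 :=
  \matrix_(j, k) 'X_(mxvec_index j k).

Definition coord_ring := quot_ring [:: (\det poly_mx)%:P * 'X - 1].

HB.instance Definition _ := GRing.ComPzRing.on coord_ring.

Definition coord_ring_hat := completion p coord_ring.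

HB.instance Definition _ := GRing.ComPzRing.on coord_ring_hat.

Definition to_hat (f : {mpoly Rhat[2 * 2]}) : coord_ring_hat :=
  to_compl p (quot_pi _ f%:P : coord_ring).

Definition cst_hat (r : Rhat) : coord_ring_hat := to_hat r%:MP.

Definition x_hat : 'M[coord_ring_hat]_2 := map_mx to_hat poly_mx.

Definition mx_hat (q : 'M[F]_2) : 'M[coord_ring_hat]_2 :=
  map_mx (fun z => cst_hat (to_Rhat z)) q.

(* Ring morphisms are p-adically continuous and the target is p-adically       *)
(* separated, so H_q and phi_0 are determined by the following conditions.     *)
Definition is_Hq (q : 'M[F]_2)
    (H : {rmorphism coord_ring_hat -> coord_ring_hat}) : Prop :=
  (forall r, H (cst_hat r) = cst_hat r) /\
  map_mx H x_hat = x_hat^T *m mx_hat q *m x_hat.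

Definition is_phi0 (deltaR : Rhat -> Rhat)
    (phi0 : {rmorphism coord_ring_hat -> coord_ring_hat}) : Prop :=
  [/\ frobenius_lift p phi0,
      forall r, phi0 (cst_hat r) = cst_hat (attached_lift p deltaR r)
    & map_mx phi0 x_hat = frob_mx p x_hat].

Definition metric_at (q : 'M[F]_2) (deltaR : Rhat -> Rhat)
    (delta : coord_ring_hat -> coord_ring_hat) : Prop :=
  exists H phi0 : {rmorphism coord_ring_hat -> coord_ring_hat},
  [/\ is_Hq q H, is_phi0 deltaR phi0
    & attached_lift p delta \o H =1 H \o phi0].

Definition ideal_p_x1 : {pred coord_ring_hat} :=
  gen_ideal [:: p%:R; x_hat ord0 ord0 - 1; x_hat ord_max ord_max - 1;
                x_hat ord0 ord_max; x_hat ord_max ord0].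

Definition christoffel (q : 'M[F]_2)
    (delta : coord_ring_hat -> coord_ring_hat) : 'M[coord_ring_hat]_2 :=
  (map_mx delta x_hat)^T *m map_mx (attached_lift p delta) (mx_hat q)
    *m frob_mx p x_hat.

End Local.

Definition is_induced_local (s : gal_of {:F}) (P P' : prime_over)
    (sR : {rmorphism Rhat P -> Rhat P'}) : Prop :=
  bijective sR /\
  (forall z, z \in local_pred P -> sR (to_Rhat P z) = to_Rhat P' (s z)).

Definition is_induced_group (P P' : prime_over)
    (sR : {rmorphism Rhat P -> Rhat P'})
    (sG : {rmorphism coord_ring_hat P -> coord_ring_hat P'})
    (sGV : coord_ring_hat P' -> coord_ring_hat P) : Prop :=
  [/\ cancel sG sGV, cancel sGV sG,
      forall r, sG (cst_hat r) = cst_hat (sR r)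
    & map_mx sG (x_hat P) = x_hat P'].

Section Connections.
Variables (P : prime_over) (sigma : 'I_2 -> gal_of {:F}).

Definition gauge_prime (i : 'I_2) : prime_over := gal_prime (sigma i) P.

Local Notation R_ i := (Rhat (gauge_prime i)).
Local Notation O_ i := (coord_ring_hat (gauge_prime i)).

Definition vertical_connection (deltaR : forall i, R_ i -> R_ i)
    (delta : forall i, O_ i -> O_ i) : Prop :=
  forall i, p_derivation p (delta i) /\
    forall r, delta i (cst_hat r) = cst_hat (deltaR i r).

Definition metric (q : 'M[F]_2) (deltaR : forall i, R_ i -> R_ i)
    (delta : forall i, O_ i -> O_ i) : Prop :=
  forall i, metric_at q (deltaR i) (delta i).

Definition torsion_free (q : 'M[F]_2) (sigGV : forall i, O_ i -> O_ ord0)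
    (delta : forall i, O_ i -> O_ i) : Prop :=
  forall i j k, sigGV i (christoffel q (delta i) j k) =
                sigGV j (christoffel q (delta j) i k).

Definition levi_civita (q : 'M[F]_2) (deltaR : forall i, R_ i -> R_ i)
    (sigGV : forall i, O_ i -> O_ ord0) (delta : forall i, O_ i -> O_ i) : Prop :=
  [/\ vertical_connection deltaR delta, metric q deltaR delta
    & torsion_free q sigGV delta].

Definition conj_lift (sigG : forall i, {rmorphism O_ ord0 -> O_ i})
    (sigGV : forall i, O_ i -> O_ ord0) (delta : forall i, O_ i -> O_ i)
    (i : 'I_2) (f : O_ ord0) : O_ ord0 :=
  sigGV i (attached_lift p (delta i) (sigG i f)).

(* The ring is p-torsion free, so this determines phi, and phi i j is additive *)
(* as the p-th part of a difference of ring morphisms.                         *)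
Definition is_curvature (sigG : forall i, {rmorphism O_ ord0 -> O_ i})
    (sigGV : forall i, O_ i -> O_ ord0) (delta : forall i, O_ i -> O_ i)
    (phi : 'I_2 -> 'I_2 -> O_ ord0 -> O_ ord0) : Prop :=
  let psi := conj_lift sigG sigGV delta in
  forall i j f, p%:R * phi i j f = psi i (psi j f) - psi j (psi i f).

End Connections.

End PrimesOverP.
End NumberField.

Arguments ideal_p_x1 {F p} P.

(* Main.v *)
Require Import Defs.
From HB Require Import structures.
From mathcomp Require Import all_boot all_order all_fingroup all_algebra all_field.
From mathcomp Require Import boolp mpoly ring zify.

Set Implicit Arguments.
Unset Strict Implicit.
Unset Printing Implicit Defensive.

Import GRing.Theory.
Local Open Scope ring_scope.

(* Write psi_i = sigma_i^-1 phi^i sigma_i, a ring endomorphism of              *)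
(* A = O(G^1)^ with psi_i a = a^p + p D_i a. Modulo p^2,                       *)
(* psi_1 (psi_2 x) = x^(p^2) + p (D_2 x)^(p), so that, A being p-torsion free, *)
(* Phi_12 = (D_2 x)^(p) - (D_1 x)^(p) mod p, and D_i x mod (p, x - 1) is read  *)
(* off the metric and torsion conditions. The answer involves D_i d mod p,     *)
(* which does not depend on i: p is unramified, so d is a p-th power mod p,    *)
(* and there a Frobenius lift is determined mod p^2.                           *)

(** At x = 1 and mod p everything reduces to linear algebra over a ring where p = 0 and 2 is
    invertible (p is odd because M is even). Torsion freeness of A ([coord_ring_hat_torsion_free])
    allows identities to be divided by p first. Put t = D_i d / d^p. For q = d 1_2 the metric
    condition says that psi_i acts on the entries of d x^t x as the p-th power; divided by p and
    read at x = 1 it becomes D_i x + (D_i x)^t = -t 1_2 ([metric_mod]). Torsion freeness identifies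
    the second column of D_1 x with the first column of D_2 x. Together they determine both
    matrices, and the off-diagonal entries of (D_2 x)^(p) - (D_1 x)^(p) ([lift_commutator]) are 2
    (t/2)^p = t^p and its opposite ([curvature_mod]).

    That t is the same for both i rests on [lift_unique_mod] and on the arithmetic input
    [pth_power_mod_p]: O_F/p is reduced because p is prime to the discriminant, and it is finite, so
    its Frobenius is bijective. [conjugate_lift] moves both Frobenius lifts to the single ring A. *)

Section Congruences.
Variables (p : nat) (A : comPzRingType).

(** The integral form of ((u + v)^p - u^p - v^p) / p. The factor [u * v] is kept in front so that it
    visibly vanishes when u v does. *)
Definition frob_defect (u v : A) : A :=
  u * v * \sum_(i < p.-1) ('C(p, i.+1) %/ p)%:R * (u ^+ (p.-2 - i) * v ^+ i).

Lemma exprD_prime (u v : A) : prime p ->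
  (u + v) ^+ p = u ^+ p + v ^+ p + p%:R * frob_defect u v.
Proof.
move=> pP; have p1 := prime_gt1 pP; rewrite exprDn.
have -> : \sum_(i < p.+1) u ^+ (p - i) * v ^+ i *+ 'C(p, i) =
  \sum_(i < p.-1.+2) u ^+ (p - i) * v ^+ i *+ 'C(p, i) by rewrite prednK // ltnW.
rewrite big_ord_recl big_ord_recr /= /bump !add1n prednK ?(ltnW p1) //.
rewrite subn0 subnn bin0 binn !expr0 mulr1 mul1r !mulr1n.
rewrite /frob_defect [X in p%:R * X]mulrC mulrA mulr_sumr mulr_suml addrA addrAC.
congr (_ + _ + _); apply: eq_bigr => i _.
have ip := ltn_ord i.
have pB : (p %| 'C(p, i.+1))%N by apply: prime_dvd_bin => //; lia.
rewrite -[in LHS](divnK pB) -mulr_natl natrM.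
rewrite (_ : (p - i.+1 = (p.-2 - i).+1)%N); last by lia.
rewrite !exprS; ring.
Qed.

Lemma expr_congr_sq (u v : A) :
  exists c, (u + p%:R * v) ^+ p = u ^+ p + p%:R ^+ 2 * c.
Proof.
(* For exponent [n.+1] = p the linear term carries p twice and is absorbed into the error. *)
suff H n : exists c, (u + p%:R * v) ^+ n.+1 =
    u ^+ n.+1 + n.+1%:R * p%:R * u ^+ n * v + p%:R ^+ 2 * c.
  case: p H => [|q] H; first by exists 0; rewrite !expr0 mulr0 addr0.
  by have [c ->] := H q; exists (u ^+ q * v + c); ring.
elim: n => [|n [c IH]]; first by exists 0; ring.
exists (n.+1%:R * u ^+ n * v ^+ 2 + c * (u + p%:R * v)).
by rewrite exprS IH [u ^+ n.+2]exprS [u ^+ n.+1]exprS; ring.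
Qed.

Definition torsion_free_by := forall a : A, p%:R * a = 0 -> a = 0.

(** Dividing by p costs one level: p a in p^(n+1) A gives a in p^n A, so coordinate n is killed by
    lifting it to coordinate n + 1. *)
Lemma completion_torsion_free :
  torsion_free_by -> forall f : completion p A, p%:R * f = 0 -> f = 0.
Proof.
move=> tf f pf0; apply: completion_eq => n.
rewrite -coordP -[Defs.coord f n.+1]quot_reprK.
set a := quot_repr _; rewrite quo_pow_transE.
have aK : quot_pi [:: p%:R ^+ n.+1 : A] a = Defs.coord f n.+1 := quot_reprK _.
have /quot_piE : quot_pi [:: p%:R ^+ n.+1 : A] (p%:R * a) =
    quot_pi [:: p%:R ^+ n.+1 : A] 0.
  rewrite rmorphM rmorph_nat rmorph0 /= aK.
  have := congr1 (fun g : completion p A => Defs.coord g n.+1) pf0.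
  suff -> : Defs.coord (p%:R * f) n.+1 = p%:R * Defs.coord f n.+1 by [].
  suff coordMn k : Defs.coord (f *+ k) n.+1 = Defs.coord f n.+1 *+ k.
    by rewrite !mulr_natl coordMn.
  by elim: k => // k IH; rewrite !mulrS -IH.
move=> /gen_idealP[c]; rewrite big_ord1 /= subr0 => pa.
rewrite -(rmorph0 (quot_pi [:: p%:R ^+ n : A])); apply/quot_piE/gen_idealP.
exists c; rewrite big_ord1 /= subr0; apply/eqP; rewrite -subr_eq0; apply/eqP.
by apply: tf; rewrite mulrBr pa exprS; ring.
Qed.
End Congruences.

(** * Arithmetic of O_F mod an unramified p *)

Section Unramified.
Variables (F : splittingFieldType rat) (D M : int) (p : nat) (P : prime_over F p).
Hypotheses (p_pr : prime p) (discF : is_discriminant F D) (DM : (D %| M)%Z)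
  (pM : ~~ (p %| M)%Z).

Local Notation O := (@ring_of_integers F).

Lemma prime_exp m z : z \in O -> z ^+ m \in P -> z \in P.
Proof.
move=> zO; elim: m => [|m IHm]; first by rewrite expr0 (negbTE (prime1 P)).
by rewrite exprS => /(prime_prime zO (rpredX _ zO)) /orP[].
Qed.

Lemma prime_sum (I : Type) (r : seq I) (Q : pred I) (f : I -> F) :
  (forall i, Q i -> f i \in P) -> \sum_(i <- r | Q i) f i \in P.
Proof.
move=> fP; apply: (big_ind (fun z => z \in P)) => //; first exact: prime0.
exact: primeD.
Qed.

Lemma prime_int_dvd (m : int) : m%:~R \in P -> (p %| m)%Z.
Proof.
move=> mP; apply/contraT => pm.
have [u [v uv]] := Bezoutz m p.
have /eqP g1 : gcdz m p == 1.
  by rewrite /gcdz eqz_nat -/(coprime _ _) coprime_sym prime_coprime.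
suff : 1 \in P by rewrite (negbTE (prime1 P)).
have -> : (1 : F) = u%:~R * m%:~R + v%:~R * p%:R.
  by rewrite pmulrn -!intrM -intrD uv g1.
by apply: primeD; apply: primeM; rewrite ?rpred_int ?prime_over_p.
Qed.

Lemma integral_basis_int n (b : n.-tuple F) :
  (forall z, z \in O <-> exists c : 'I_n -> int, z = \sum_i (c i)%:~R * tnth b i) ->
  forall i, tnth b i \in O.
Proof.
move=> b_int i; apply/b_int; exists (fun j => (i == j)%:R).
rewrite (bigD1 i) //= eqxx mul1r big1 ?addr0 // => j /negbTE ji.
by rewrite eq_sym ji mul0r.
Qed.

(* The hypothesis puts every conjugate of y in P, hence also the traces of the *)
(* y b_j; inverting the trace form, D times each coordinate of y is in P, and  *)
(* D is prime to p. This is how the discriminant says that p is unramified.    *)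
Lemma nilpotent_mod_p m y u : y \in O -> u \in O -> y ^+ m = p%:R * u ->
  exists2 v, v \in O & y = p%:R * v.
Proof.
move=> yO uO ypu; have [b [b_basis b_int detE]] := discF.
have bO := integral_basis_int b_int.
have /b_int[c yE] := yO.
have conj_P (s : gal_of {:F}) : s y \in P.
  apply: (@prime_exp m); first exact: gal_ring_of_integers.
  rewrite -rmorphXn ypu rmorphM rmorph_nat mulrC.
  by apply: primeM; [exact: gal_ring_of_integers | exact: prime_over_p].
set T := \matrix_(i, j) _ in detE.
have TO i j : T i j \in O.
  by rewrite mxE rpred_sum // => s _; apply: gal_ring_of_integers; apply: rpredM.
have TP j : \sum_i (c i)%:~R * T i j \in P.
  have -> : \sum_i (c i)%:~R * T i j = galTrace 1 {:F} (tnth b j * y).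
    rewrite yE mulr_sumr raddf_sum; apply: eq_bigr => i _.
    by rewrite mxE !mulrzl mulrzAr raddfMz [tnth b i * _]mulrC.
  apply: prime_sum => s _; rewrite rmorphM; apply: primeM; last exact: conj_P.
  exact: gal_ring_of_integers.
have detO (n : nat) (A : 'M[F]_n) : (forall i j, A i j \in O) -> \det A \in O.
  move=> AO; rewrite /determinant; apply: rpred_sum => t _.
  by rewrite rpredM ?rpred_sign ?rpred_prod.
have pc i : (p %| c i)%Z.
  have /prime_int_dvd : (c i * D)%:~R \in P.
    have -> : (c i * D)%:~R = \sum_j (\adj T) j i * \sum_k (c k)%:~R * T k j.
      transitivity (((\row_k (c k)%:~R) *m (T *m \adj T)) 0 i).
        by rewrite mul_mx_adj -detE mul_mx_scalar !mxE intrM mulrC.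
      rewrite mulmxA mxE; apply: eq_bigr => l _; rewrite mulrC; congr (_ * _).
      by rewrite mxE; apply: eq_bigr => k _; rewrite mxE.
    apply: prime_sum => l _; apply: primeM; last exact: TP.
    rewrite mxE.
    rewrite rpredM ?rpred_sign //.
    by apply: detO => k h; rewrite 2!mxE; apply: TO.
  rewrite dvdzE /= abszM Euclid_dvdM // => /orP[//|pD].
  by case/negP: pM; apply: dvdz_trans DM.
exists (\sum_i (c i %/ p)%Z%:~R * tnth b i).
  by apply: rpred_sum => i _; rewrite rpredM ?rpred_int.
rewrite yE mulr_sumr; apply: eq_bigr => i _.
by rewrite -[in LHS](divzK (pc i)) intrM mulrCA mulrA.
Qed.

Lemma frob_defect_int u v : u \in O -> v \in O -> frob_defect p u v \in O.
Proof.
move=> uO vO; rewrite /frob_defect rpredM ?rpred_sum // => [|i _].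
  exact: rpredM.
by rewrite rpredM ?rpred_nat // rpredM ?rpredX.
Qed.

(** Since (U - V)^p is congruent to U^p - V^p mod p and O_F/p is reduced, Frobenius is injective on
    O_F/p; the induction strips one Frobenius at a time. *)
Lemma frob_inj_mod_p k u v g : u \in O -> v \in O -> g \in O ->
  u ^+ (p ^ k) = v ^+ (p ^ k) + p%:R * g -> exists2 h, h \in O & u = v + p%:R * h.
Proof.
move=> uO vO; elim: k g => [|k IHk] g gO; first by exists g.
rewrite expnSr !exprM; set U := u ^+ _; set V := v ^+ _ => UV.
have [UO VO] : U \in O /\ V \in O by rewrite !rpredX.
have UVE := exprD_prime V (U - V) p_pr; rewrite [V + _]addrC subrK in UVE.
have [|||w wO wE] := @nilpotent_mod_p p (U - V) (g - frob_defect p V (U - V)).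
- exact: rpredB.
- by rewrite rpredB // frob_defect_int // rpredB.
- by apply: (addrI (V ^+ p)); rewrite mulrBr [RHS]addrA -UV UVE; ring.
by apply: (IHk w) => //; rewrite -/U -/V -wE addrC subrK.
Qed.

(* The powers y ^ (p ^ k) take finitely many values mod p, so the injectivity  *)
(* of Frobenius makes y itself a Frobenius iterate of y.                       *)
Lemma pth_power_mod_p y : y \in O ->
  exists b c, [/\ b \in O, c \in O & y = b ^+ p + p%:R * c].
Proof.
move=> yO; have [b [b_basis b_int _]] := discF.
have bO := integral_basis_int b_int.
have coefs k : exists c : 'I_(\dim {:F}) -> int,
    y ^+ (p ^ k) = \sum_i (c i)%:~R * tnth b i.
  by apply/b_int; rewrite rpredX.
pose c k := projT1 (cid (coefs k)).
have cE k : y ^+ (p ^ k) = \sum_i (c k i)%:~R * tnth b i by rewrite /c; case: cid.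
pose T := {ffun 'I_(\dim {:F}) -> 'I_p.-1.+1}.
(* Pigeonhole: the coordinates mod p of y^(p^k) lie in the finite set [T], so two of the #|T| + 1
   exponents give the same class. *)
pose f (k : 'I_#|T|.+1) : T := [ffun i => inord `|(c k i %% p)%Z|%N].
have p0 : (p%:Z != 0) by rewrite eqz_nat -lt0n prime_gt0.
have modE (m : int) : `|(m %% p)%Z|%N = (m %% p)%Z :> int.
  by rewrite gez0_abs // modz_ge0.
have mod_lt (m : int) : (`|(m %% p)%Z|%N < p.-1.+1)%N.
  by rewrite prednK ?prime_gt0 // -ltz_nat modE ltz_pmod // ltz_nat prime_gt0.
have /injectivePn[k [l kl /ffunP fkl]] : ~~ injectiveb f.
  by apply/injectiveP => /leq_card; rewrite card_ord ltnn.
wlog lt_kl : k l kl fkl / (k < l)%N.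
  move=> H; case: (ltngtP k l) => [|lk|/val_inj /eqP]; first exact: H.
    by apply: (H l k) => //; rewrite eq_sym.
  by rewrite (negbTE kl).
have pc i : (p %| c k i - c l i)%Z.
  rewrite -eqz_mod_dvd; apply/eqP; have := congr1 val (fkl i).
  by rewrite !ffunE /= !inordK // => /(congr1 Posz); rewrite !modE.
have [|||h hO yE] := @frob_inj_mod_p k y (y ^+ (p ^ (l - k)))
    (\sum_i ((c k i - c l i) %/ p)%Z%:~R * tnth b i) yO.
- exact: rpredX.
- by rewrite rpred_sum // => i _; rewrite rpredM ?rpred_int.
- rewrite -exprM -expnD subnK ?(ltnW lt_kl) // !cE mulr_sumr -big_split /=.
  apply: eq_bigr => i _; rewrite mulrA [p%:R * _]mulrC pmulrn -intrM divzK //.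
  by rewrite intrB; ring.
(* By now y = y^(p^(l - k)) mod p with l - k > 0, so one Frobenius can be split off. *)
exists (y ^+ (p ^ (l - k).-1)), h; split => //; first exact: rpredX.
by rewrite -exprM -expnSr prednK ?subn_gt0.
Qed.

(** Denominators are cleared by M^(kp), itself a p-th power, so a root b found in O_F yields the
    root b / M^k. *)
Lemma integers_inv_pth_power z : z \in @integers_inv F M ->
  exists b c, [/\ b \in @integers_inv F M, c \in @integers_inv F M
                & z = b ^+ p + p%:R * c].
Proof.
move=> /asboolP[k zO].
have MO : M%:~R \in O by rewrite rpred_int.
have M0 : (M%:~R : F) != 0.
  rewrite -(rmorph_int (in_alg F)) fmorph_eq0 intr_eq0.
  by apply: contraNneq pM => ->; rewrite dvdz0.
have [|b [c [bO cO zE]]] := @pth_power_mod_p (M%:~R ^+ (k * p) * z).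
  have -> : (k * p = k * p.-1 + k)%N by rewrite -mulnSr prednK ?prime_gt0.
  by rewrite exprD -mulrA rpredM // rpredX.
have Mk0 m : (M%:~R : F) ^+ m != 0 by rewrite expf_neq0.
have inv_in m t : t \in O -> t / M%:~R ^+ m \in @integers_inv F M.
  by move=> tO; apply/asboolP; exists m; rewrite mulrC divfK.
exists (b / M%:~R ^+ k), (c / M%:~R ^+ (k * p)); split; try exact: inv_in.
apply: (mulfI (Mk0 (k * p)%N)); rewrite zE mulrDr expr_div_n -exprM.
by rewrite [RHS]addrC mulrCA ![_ * (_ / _)]mulrC !divfK // addrC.
Qed.
End Unramified.

(** * Torsion freeness of the coordinate rings *)

Section Polynomials.
Variables (p : nat) (A : comNzRingType).
Hypothesis tfA : torsion_free_by p A.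

Lemma poly_torsion_free : torsion_free_by p {poly A}.
Proof.
move=> f pf; apply/polyP => i; rewrite coef0; apply: tfA.
by have /(congr1 (fun g : {poly A} => g`_i)) := pf; rewrite coef0 -polyC_natr coefCM.
Qed.

Lemma mpoly_torsion_free n : torsion_free_by p ({mpoly A[n]}).
Proof.
move=> f pf; apply/mpolyP => m; rewrite mcoeff0; apply: tfA.
by rewrite mulr_natl -mcoeffMn -mulr_natl pf mcoeff0.
Qed.

(* u X - 1 is a nonzerodivisor mod p because its constant coefficient is -1.   *)
Lemma inverted_torsion_free (u : A) :
  torsion_free_by p (quot_ring [:: u%:P * 'X - 1 : {poly A}]).
Proof.
move=> v; rewrite -[v]quot_reprK; set f := quot_repr v => pf0.
have /quot_piE/gen_idealP[c] :
    quot_pi [:: u%:P * 'X - 1] (p%:R * f) = quot_pi [:: u%:P * 'X - 1] 0.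
  by rewrite rmorphM rmorph_nat rmorph0 /= pf0.
rewrite big_ord1 /= subr0; set g := c 0%N => pf.
have coefE i : (g * (u%:P * 'X - 1))`_i = (if i is j.+1 then u * g`_j else 0) - g`_i.
  rewrite mulrBr mulr1 coefB mulrCA coefCM coefMX.
  by case: i => [|i] //=; rewrite mulr0.
have pg i : exists b, g`_i = p%:R * b.
  elim: i => [|i [b gb]].
    exists (- f`_0); have := coefE 0%N; rewrite -pf -polyC_natr coefCM sub0r => H.
    by rewrite mulrN H opprK.
  exists (u * b - f`_i.+1).
  have := coefE i.+1; rewrite -pf -polyC_natr coefCM gb => H.
  by rewrite mulrBr H mulrCA; ring.
pose h : {poly A} := \poly_(i < size g) projT1 (cid (pg i)).
have gh : g = p%:R * h.
  apply/polyP => i; rewrite -polyC_natr coefCM coef_poly.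
  case: ltnP => [_|gi]; first by case: cid.
  by rewrite mulr0 nth_default.
rewrite -(rmorph0 (quot_pi _)); apply/quot_piE/gen_idealP; exists (fun=> h).
rewrite big_ord1 /= subr0; apply/eqP; rewrite -subr_eq0; apply/eqP.
by apply: poly_torsion_free; rewrite mulrBr pf gh mulrA subrr.
Qed.
End Polynomials.

Section Geometry.
Variables (F : splittingFieldType rat) (p : nat) (P : prime_over F p).
Hypothesis p_pr : prime p.

Lemma local_torsion_free : torsion_free_by p (local P).
Proof.
move=> a /(congr1 (val : local P -> F)).
rewrite rmorphM rmorph_nat rmorph0 mulr_natl -scaler_nat => /eqP.
rewrite scaler_eq0 Num.Theory.pnatr_eq0 eqn0Ngt prime_gt0 //= => /eqP a0.
by apply: val_inj; rewrite rmorph0.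
Qed.

Lemma coord_ring_hat_torsion_free : torsion_free_by p (coord_ring_hat P).
Proof.
apply: completion_torsion_free; apply: inverted_torsion_free.
apply: mpoly_torsion_free; apply: completion_torsion_free.
exact: local_torsion_free.
Qed.
End Geometry.

Lemma ord2_ind (Q : 'I_2 -> Prop) : Q ord0 -> Q ord_max -> forall i, Q i.
Proof.
move=> Q0 Q1 i; have [->|->] // : i = ord0 \/ i = ord_max.
by case: i => [[|[|i]] // lt_i]; [left | right]; apply: val_inj.
Qed.

Lemma big_ord2 (V : nmodType) (f : 'I_2 -> V) : \sum_i f i = f ord0 + f ord_max.
Proof. by rewrite big_ord_recr big_ord1 /=; congr (f _ + _); apply: val_inj. Qed.

(** * Frobenius lifts mod p^2 and their commutator *)

Section FrobeniusLifts.
Variables (p : nat) (A : comPzRingType).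
Hypotheses (p_pr : prime p) (tfA : torsion_free_by p A).

Definition lift_with (D psi : A -> A) := forall a, psi a = a ^+ p + p%:R * D a.

Lemma torsion_free_cancel (a b : A) : p%:R * a = p%:R * b -> a = b.
Proof.
by move=> ab; apply/eqP; rewrite -subr_eq0; apply/eqP/tfA; rewrite mulrBr ab subrr.
Qed.

(** The values of [D] enter only mod p^2, since (b^p + p D b)^p = b^(p^2) mod p^2. With c = D_2 a
    this computes psi_1 (psi_2 a); with b^p + p c = d it compares two lifts at d. *)
Lemma lift_pth_power (psi : {rmorphism A -> A}) D (b c : A) : lift_with D psi ->
  exists r, psi (b ^+ p + p%:R * c) = b ^+ (p * p) + p%:R * c ^+ p + p%:R ^+ 2 * r.
Proof.
move=> psiE; rewrite rmorphD rmorphM rmorphXn rmorph_nat !psiE.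
have [r ->] := expr_congr_sq p (b ^+ p) (D b).
by exists (r + D c); rewrite -exprM; ring.
Qed.

(* psi (b ^ p + p c) = b ^ (p ^ 2) + p c ^ p mod p ^ 2 for every lift psi.     *)
Lemma lift_unique_mod (psi1 psi2 : {rmorphism A -> A}) D1 D2 (w b c : A) :
  lift_with D1 psi1 -> lift_with D2 psi2 -> w = b ^+ p + p%:R * c ->
  exists r, D1 w = D2 w + p%:R * r.
Proof.
move=> psi1E psi2E wE.
have [r1] := lift_pth_power b c psi1E; have [r2] := lift_pth_power b c psi2E.
rewrite -wE => w2 w1; exists (r1 - r2); apply: torsion_free_cancel.
apply: (addrI (w ^+ p)); rewrite -psi1E w1.
transitivity (psi2 w + p%:R ^+ 2 * (r1 - r2)); first by rewrite w2; ring.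
by rewrite psi2E; ring.
Qed.

(** Both composites start with a^(p^2), which cancels; dividing by p leaves the p-th powers and an
    error in p A. *)
Lemma lift_commutator (psi1 psi2 : {rmorphism A -> A}) D1 D2 (a f : A) :
  lift_with D1 psi1 -> lift_with D2 psi2 ->
  p%:R * f = psi1 (psi2 a) - psi2 (psi1 a) ->
  exists r, f = D2 a ^+ p - D1 a ^+ p + p%:R * r.
Proof.
move=> psi1E psi2E fE.
have [r1 e1] := lift_pth_power a (D2 a) psi1E.
have [r2 e2] := lift_pth_power a (D1 a) psi2E.
exists (r1 - r2); apply: torsion_free_cancel.
by rewrite fE [in psi1 _]psi2E [in psi2 _]psi1E e1 e2; ring.
Qed.

(** * Evaluation at x = 1 mod p *)

Section Metric.
Variables (B : comPzRingType) (red : {rmorphism A -> B}) (x : 'M[A]_2).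
Hypotheses (red_p : red p%:R = 0) (red_x : forall i j, red (x i j) = (i == j)%:R).

Lemma red_lift psi D a : lift_with D psi -> red (psi a) = red a ^+ p.
Proof. by move=> ->; rewrite rmorphD rmorphM rmorphXn red_p mul0r addr0. Qed.

Lemma red_x_exp i j : red (x i j) ^+ p = (i == j)%:R.
Proof.
rewrite red_x; case: (i == j); rewrite ?expr1n //.
by rewrite -(prednK (prime_gt0 p_pr)) exprS mul0r.
Qed.

(** This is the p-linear part of the metric equation. The p-th power of the sum on the right
    contributes only a [frob_defect], which dies at x = 1. *)
Lemma metric_mod (psi : {rmorphism A -> A}) D (w : A) j k :
  lift_with D psi ->
  psi w * (\sum_l psi (x l j) * psi (x l k)) =
    w ^+ p * (\sum_l x l j * x l k) ^+ p ->
  red (D w) * (j == k)%:R + red w ^+ p * (red (D (x j k)) + red (D (x k j))) = 0.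
Proof.
move=> psiE; rewrite !big_ord2 exprD_prime //.
(* One of [x ord0 j], [x ord_max j] is off-diagonal and reduces to 0, and their product divides the
   defect. *)
have : red (frob_defect p (x ord0 j * x ord0 k) (x ord_max j * x ord_max k)) = 0.
  rewrite /frob_defect !rmorphM !red_x.
  by elim/ord2_ind: j; rewrite /= ?mul0r ?mulr0 ?mul0r.
move: (frob_defect _ _ _) => fd fd0 E.
(* The metric equation after cancelling its common part and dividing by p; only now can it be
   reduced without losing it. *)
have {E} /(congr1 red) :
  D w * (x ord0 j ^+ p * x ord0 k ^+ p + x ord_max j ^+ p * x ord_max k ^+ p)
  + psi w * (x ord0 j ^+ p * D (x ord0 k) + D (x ord0 j) * x ord0 k ^+ p
     + x ord_max j ^+ p * D (x ord_max k) + D (x ord_max j) * x ord_max k ^+ p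
     + p%:R * (D (x ord0 j) * D (x ord0 k) + D (x ord_max j) * D (x ord_max k)))
  = w ^+ p * fd.
  apply: torsion_free_cancel; rewrite !psiE in E *.
  apply: (addrI (w ^+ p *
    ((x ord0 j * x ord0 k) ^+ p + (x ord_max j * x ord_max k) ^+ p))).
  transitivity (w ^+ p * ((x ord0 j * x ord0 k) ^+ p
    + (x ord_max j * x ord_max k) ^+ p + p%:R * fd)); last by ring.
  by rewrite -E !exprMn; ring.
rewrite !(rmorphD, rmorphM, rmorphXn) /= (red_lift _ psiE) red_p fd0.
rewrite !red_x_exp mulr0 mul0r addr0 => <-.
by elim/ord2_ind: j; elim/ord2_ind: k => /=; ring.
Qed.

(* At x = 1 and mod p, the metric condition gives D_i x the diagonal -t/2 and  *)
(* an antisymmetric off-diagonal part, and torsion freeness then forces        *)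
(* D1 x = t/2 [-1, -1; 1, -1] and D2 x = t/2 [-1, 1; -1, -1].                  *)
Lemma curvature_mod (psi1 psi2 : {rmorphism A -> A}) D1 D2 (w b c : A) (v t : B) :
  odd p -> lift_with D1 psi1 -> lift_with D2 psi2 ->
  w = b ^+ p + p%:R * c -> red w * v = 1 -> t * red w ^+ p = red (D1 w) ->
  (forall j k, psi1 w * (\sum_l psi1 (x l j) * psi1 (x l k)) =
               w ^+ p * (\sum_l x l j * x l k) ^+ p) ->
  (forall j k, psi2 w * (\sum_l psi2 (x l j) * psi2 (x l k)) =
               w ^+ p * (\sum_l x l j * x l k) ^+ p) ->
  (forall k, psi1 w * (\sum_l D1 (x l ord_max) * x l k ^+ p) =
             psi2 w * (\sum_l D2 (x l ord0) * x l k ^+ p)) ->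
  forall j k f, p%:R * f = psi1 (psi2 (x j k)) - psi2 (psi1 (x j k)) ->
  red f = mx2 0 (t ^+ p) (- t ^+ p) 0 j k.
Proof.
move=> p_odd psi1E psi2E wE wv tE met1 met2 tor j k f fE.
have B_p : p%:R = 0 :> B by rewrite -red_p rmorph_nat.
have cancel_w (y z : B) : red w ^+ p * y = red w ^+ p * z -> y = z.
  move=> /(congr1 ( *%R (v ^+ p))).
  by rewrite !mulrA -exprMn [v * _]mulrC wv expr1n !mul1r.
have tE2 : t * red w ^+ p = red (D2 w).
  have [r ->] := lift_unique_mod psi2E psi1E wE.
  by rewrite rmorphD rmorphM red_p mul0r addr0.
have sym D (psi : {rmorphism A -> A}) :
    lift_with D psi -> t * red w ^+ p = red (D w) ->
    (forall j k, psi w * (\sum_l psi (x l j) * psi (x l k)) =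
       w ^+ p * (\sum_l x l j * x l k) ^+ p) ->
    forall j k, red (D (x j k)) + red (D (x k j)) = - (t * (j == k)%:R).
  move=> psiE DwE met j' k'; apply: cancel_w; have := metric_mod psiE (met j' k').
  by rewrite -DwE => /eqP; rewrite addrC addr_eq0 => /eqP ->; ring.
(* At x = 1 the sum over l keeps only one entry, and psi_1 w, psi_2 w both reduce to the invertible
   w^p. *)
have {}tor i : red (D1 (x i ord_max)) = red (D2 (x i ord0)).
  apply: cancel_w; have /(congr1 red) := tor i.
  rewrite !big_ord2 !(rmorphM, rmorphD, rmorphXn) /= !red_x_exp.
  rewrite (red_lift _ psi1E) (red_lift _ psi2E).
  by elim/ord2_ind: i => /=; rewrite !mulr1 !mulr0 ?addr0 ?add0r.
(* The inverse of 2 in [B]: p = 1 + 2 (p - 1)/2 and p = 0 there. *)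
pose s : B := - (p./2)%:R.
have s2 : 2%:R * s = 1.
  have := odd_double_half p; rewrite p_odd -muln2 => /(congr1 (fun n => n%:R : B)).
  by rewrite natrD natrM B_p addrC => /eqP; rewrite addr_eq0 => /eqP;
    rewrite /s mulrN mulrC => ->; rewrite opprK.
have half (y z : B) : y + y = z -> y = s * z.
  by move=> <-; rewrite -mulr2n -mulr_natl mulrA [s * _]mulrC s2 mul1r.

have {tE}sym1 := sym _ _ psi1E tE met1; have {tE2 sym}sym2 := sym _ _ psi2E tE2 met2.
have D100 : red (D1 (x ord0 ord0)) = - (s * t).
  by rewrite [LHS](half _ _ (sym1 _ _)) eqxx mulr1 mulrN.
have D111 : red (D1 (x ord_max ord_max)) = - (s * t).
  by rewrite [LHS](half _ _ (sym1 _ _)) eqxx mulr1 mulrN.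
have D200 : red (D2 (x ord0 ord0)) = - (s * t).
  by rewrite [LHS](half _ _ (sym2 _ _)) eqxx mulr1 mulrN.
have D211 : red (D2 (x ord_max ord_max)) = - (s * t).
  by rewrite [LHS](half _ _ (sym2 _ _)) eqxx mulr1 mulrN.
have D101 : red (D1 (x ord0 ord_max)) = - (s * t) by rewrite tor.
have D210 : red (D2 (x ord_max ord0)) = - (s * t) by rewrite -tor.
have D110 : red (D1 (x ord_max ord0)) = s * t.
  by have /eqP := sym1 ord_max ord0; rewrite mulr0 oppr0 addr_eq0 D101 opprK => /eqP.
have D201 : red (D2 (x ord0 ord_max)) = s * t.
  by have /eqP := sym2 ord0 ord_max; rewrite mulr0 oppr0 addr_eq0 D210 opprK => /eqP.
have expN (y : B) : (- y) ^+ p = - y ^+ p by rewrite exprNn -signr_odd p_odd mulN1r.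
(* Since 2^p = 2 where p = 0, two copies of (t/2)^p add up to t^p. *)
have s2p : 2%:R * s ^+ p = 1.
  suff <- : 2%:R ^+ p = 2%:R :> B by rewrite -exprMn s2 expr1n.
  by rewrite -[2%N]/(1 + 1)%N natrD exprD_prime // B_p mul0r addr0 expr1n.
have {s2p}tpE : t ^+ p = (s * t) ^+ p + (s * t) ^+ p.
  by rewrite -mulr2n -mulr_natl exprMn mulrA s2p mul1r.
have [r ->] := lift_commutator psi1E psi2E fE.
rewrite rmorphD rmorphB !rmorphM !rmorphXn /= red_p mul0r addr0 mxE tpE.
elim/ord2_ind: j fE => _; elim/ord2_ind: k => /=;
  rewrite ?D100 ?D101 ?D110 ?D111 ?D200 ?D201 ?D210 ?D211 ?expN; ring.
Qed.
End Metric.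
End FrobeniusLifts.

Lemma quot_pi_gen (A : comPzRingType) (s : seq A) i :
  (i < size s)%N -> quot_pi s s`_i = 0.
Proof.
move=> lt_i; rewrite -(rmorph0 (quot_pi s)); apply/quot_piE/gen_idealP.
exists (fun j => (j == i)%:R); rewrite subr0 (bigD1 (Ordinal lt_i)) //= eqxx mul1r.
rewrite big1 ?addr0 // => j ji; rewrite (_ : (j == i :> nat) = false) ?mul0r //.
exact: negbTE ji.
Qed.

Lemma p_derivation_lift (p : nat) (A : comPzRingType) (delta : A -> A) :
  p_derivation p delta ->
  exists phi : {rmorphism A -> A}, phi =1 attached_lift p delta.
Proof.
move=> [zphi mphi].
pose zm := GRing.isZmodMorphism.Build A A (attached_lift p delta) zphi.
pose mm := GRing.isMonoidMorphism.Build A A (attached_lift p delta) mphi.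
pose phi : {rmorphism A -> A} := HB.pack (attached_lift p delta) zm mm.
by exists phi.
Qed.

Lemma rmorphism_inverse (A A' : comPzRingType) (s : {rmorphism A -> A'})
    (s' : A' -> A) :
  cancel s s' -> cancel s' s -> exists sV : {rmorphism A' -> A}, sV =1 s'.
Proof.
move=> sK s'K.
pose zm := GRing.isZmodMorphism.Build A' A s' (can2_zmod_morphism sK s'K).
pose mm := GRing.isMonoidMorphism.Build A' A s' (can2_monoid_morphism sK s'K).
pose sV : {rmorphism A' -> A} := HB.pack s' zm mm.
by exists sV.
Qed.

(** * Constants from F, and transport to the ring of the first prime *)

Section Constants.
Variables (F : splittingFieldType rat) (p : nat) (P : prime_over F p).

Fact cst_hat_zmod_morphism : zmod_morphism (@cst_hat F p P).
Proof. by move=> r t; rewrite /cst_hat /to_hat !rmorphB. Qed.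

Fact cst_hat_monoid_morphism : monoid_morphism (@cst_hat F p P).
Proof. split=> [|r t]; rewrite /cst_hat /to_hat.
  by rewrite mpolyC1 polyC1 (rmorph1 (quot_pi _)) (rmorph1 (@to_compl p _)).
by rewrite mpolyCM polyCM (rmorphM (quot_pi _)) (rmorphM (@to_compl p _)). Qed.

HB.instance Definition _ := GRing.isZmodMorphism.Build _ _ (@cst_hat F p P)
  cst_hat_zmod_morphism.
HB.instance Definition _ := GRing.isMonoidMorphism.Build _ _ (@cst_hat F p P)
  cst_hat_monoid_morphism.

Lemma to_localK z : z \in local_pred P -> val (to_local P z) = z.
Proof. exact: insubdK. Qed.

Lemma to_Rhat0 : to_Rhat P 0 = 0.
Proof.
rewrite /to_Rhat (_ : to_local P 0 = 0) ?rmorph0 //.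
exact: (valKd 0 (0 : local P)).
Qed.

Lemma mx_hat_scalar z : mx_hat P z%:M = (cst_hat (to_Rhat P z))%:M.
Proof.
apply/matrixP => i j; rewrite !mxE; case: (i == j) => //.
by rewrite mulr0n to_Rhat0 rmorph0.
Qed.

Lemma to_Rhat_unit z : z != 0 -> z \in local_pred P -> z^-1 \in local_pred P ->
  to_Rhat P z \is a GRing.unit.
Proof.
move=> z0 zP zVP; apply/unitrPr; exists (to_Rhat P z^-1).
rewrite -rmorphM (_ : _ * _ = 1) ?rmorph1 //.
by apply: val_inj; rewrite rmorphM rmorph1 /= !to_localK // divff.
Qed.

Lemma to_Rhat_pth_power (D M : int) z : prime p -> is_discriminant F D ->
  (D %| M)%Z -> ~~ (p %| M)%Z -> z \in integers_inv M ->
  exists b c, to_Rhat P z = b ^+ p + p%:R * c.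
Proof.
move=> p_pr discF DM pM zM.
have [b [c [bM cM zE]]] := integers_inv_pth_power P p_pr discF DM pM zM.
have inP := integers_inv_local P p_pr pM.
exists (to_Rhat P b), (to_Rhat P c).
rewrite -rmorphXn -[p%:R](rmorph_nat (@to_compl p _)) -rmorphM -rmorphD.
congr to_compl; apply: val_inj.
by rewrite rmorphD rmorphM rmorphXn rmorph_nat /= !to_localK ?inP.
Qed.
End Constants.

(** Conjugation by sigma_i replaces the lift on O(G^i)^ by psi_i on A, with D_i the conjugate of
    delta^i. As sigma_i matches the matrices x and the constants d, the metric and torsion
    expressions keep their shape. *)
Lemma conjugate_lift (p : nat) (A A' : comPzRingType) (s : {rmorphism A -> A'})
    (s' : A' -> A) (delta : A' -> A') (x : 'M[A]_2)
    (x' : 'M[A']_2) (w : A) (w' : A') :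
  cancel s s' -> cancel s' s -> map_mx s x = x' -> s w = w' ->
  p_derivation p delta ->
  (forall j k, attached_lift p delta (w' * \sum_l x' l j * x' l k) =
     (w' * \sum_l x' l j * x' l k) ^+ p) ->
  let D := s' \o delta \o s in
  exists psi : {rmorphism A -> A},
  [/\ forall f, psi f = s' (attached_lift p delta (s f)),
      lift_with p D psi,
      forall j k, psi w * (\sum_l psi (x l j) * psi (x l k)) =
        w ^+ p * (\sum_l x l j * x l k) ^+ p
    & forall j k,
        s' (attached_lift p delta w' * \sum_l delta (x' l j) * x' l k ^+ p) =
        psi w * (\sum_l D (x l j) * x l k ^+ p)].
Proof.
move=> sK s'K <- <- /p_derivation_lift[phi phiE] met.
have [sV sVE] := rmorphism_inverse sK s'K.
have sVK : cancel s sV by move=> f; rewrite sVE sK.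
exists (sV \o phi \o s : {rmorphism _ -> _}); split=> /=.
- by move=> f; rewrite sVE phiE.
- move=> f /=; rewrite phiE /attached_lift rmorphD rmorphM rmorphXn rmorph_nat.
  by rewrite sVK sVE.
- move=> j k; have := met j k.
  have -> : \sum_l map_mx s x l j * map_mx s x l k = s (\sum_l x l j * x l k).
    by rewrite rmorph_sum; apply: eq_bigr => l _; rewrite !mxE rmorphM.
  rewrite -rmorphM -phiE => /(congr1 sV).
  rewrite -rmorphXn sVK exprMn => <-.
  by rewrite !rmorphM !rmorph_sum; congr (_ * _);
    apply: eq_bigr => l _; rewrite !rmorphM.
- move=> j k; rewrite -sVE -phiE rmorphM rmorph_sum; congr (_ * _).
  by apply: eq_bigr => l _; rewrite rmorphM rmorphXn !mxE sVK sVE.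
Qed.

Section ScalarMetric.
Variables (F : splittingFieldType rat) (p : nat) (P : prime_over F p) (d : F).
Variables (deltaR : Rhat P -> Rhat P) (delta : coord_ring_hat P -> coord_ring_hat P).

Let w := cst_hat (to_Rhat P d).
Let x := x_hat P.

(** Here H_q sends x_jk to an entry of d x^t x, and phi_0 raises x_jk to the p-th power, so H_q
    (phi_0 x_jk) is the p-th power of that entry. *)
Lemma metric_scalar : metric_at d%:M deltaR delta -> forall j k,
  attached_lift p delta (w * \sum_l x l j * x l k) = (w * \sum_l x l j * x l k) ^+ p.
Proof.
move=> [H [phi0 [[_ Hx] [_ _ phi0x] Hmet]]] j k.
have HxE : H (x j k) = w * \sum_l x l j * x l k.
  transitivity (map_mx H x j k); first by rewrite [RHS]mxE.
  rewrite Hx mx_hat_scalar mul_mx_scalar -scalemxAl mxE mxE; congr (_ * _).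
  by apply: eq_bigr => l _; rewrite [_^T _ _]mxE.
have := Hmet (x j k); rewrite /= HxE => ->; rewrite -HxE -rmorphXn; congr (H _).
by transitivity (map_mx phi0 x j k); [rewrite [RHS]mxE | rewrite phi0x [LHS]mxE].
Qed.

Lemma christoffel_scalar : p_derivation p delta -> forall j k,
  christoffel d%:M delta j k =
    attached_lift p delta w * \sum_l delta (x l j) * x l k ^+ p.
Proof.
move=> [dz _] j k; rewrite /christoffel mx_hat_scalar -/w -/x.
have -> : map_mx (attached_lift p delta) w%:M =
    (attached_lift p delta w)%:M :> 'M_2.
  apply/matrixP => i l; rewrite !mxE; case: (i == l) => //.
  by rewrite mulr0n -[X in attached_lift _ _ X](subrr 0) dz subrr.
rewrite mul_mx_scalar -scalemxAl mxE mxE; congr (_ * _).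
apply: eq_bigr => l _; rewrite [frob_mx _ _ _ _]mxE; congr (_ * _).
by rewrite [LHS]mxE [LHS]mxE.
Qed.
End ScalarMetric.

Theorem corollary3p7 (F : splittingFieldType rat) (D M : int)
    (sigma : 'I_2 -> gal_of {:F}) (p : nat) (P : prime_over F p) (d : F)
    (galF : galois 1 {:F}) (discF : is_discriminant F D)
    (evenM : (2 %| M)%Z) (discM : (D %| M)%Z)
    (sigmaGal : forall i, sigma i \in 'Gal({:F} / 1)%g)
    (sigma1 : sigma ord0 = 1%g)
    (p_prime : prime p) (pM : ~~ (p %| M)%Z)
    (d_unit : integers_inv_unit M d) (d_inv : sigma ord_max d = d)
    (deltaR : forall i, Rhat (gauge_prime P sigma i) -> Rhat (gauge_prime P sigma i))
    (deltaRP : forall i, p_derivation p (deltaR i))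
    (sigR : forall i, {rmorphism Rhat (gauge_prime P sigma ord0)
                         -> Rhat (gauge_prime P sigma i)})
    (sigRP : forall i, is_induced_local (sigma i) (sigR i))
    (sigG : forall i, {rmorphism coord_ring_hat (gauge_prime P sigma ord0)
                         -> coord_ring_hat (gauge_prime P sigma i)})
    (sigGV : forall i, coord_ring_hat (gauge_prime P sigma i)
                         -> coord_ring_hat (gauge_prime P sigma ord0))
    (sigGP : forall i, is_induced_group (sigR i) (sigG i) (sigGV i))
    (delta : forall i, coord_ring_hat (gauge_prime P sigma i)
                         -> coord_ring_hat (gauge_prime P sigma i))
    (deltaLC : levi_civita d%:M deltaR sigGV delta)
    (phi : 'I_2 -> 'I_2 -> coord_ring_hat (gauge_prime P sigma ord0)
                        -> coord_ring_hat (gauge_prime P sigma ord0))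
    (phiP : is_curvature sigG sigGV delta phi) :
  let P1 := gauge_prime P sigma ord0 in
  let d1 := to_Rhat P1 d in
  let e := cst_hat (deltaR ord0 d1 / d1 ^+ p) ^+ p in
  let Phi12 := map_mx (phi ord0 ord_max) (x_hat P1) in
  forall j k, Phi12 j k - mx2 0 e (- e) 0 j k \in ideal_p_x1 P1.
Proof.
move=> P1 d1 e Phi12 j k.
have [conn met tor] := deltaLC; have [d0 dM dVM] := d_unit.
have inP1 z : z \in integers_inv M -> z \in local_pred P1.
  exact: integers_inv_local p_prime pM.
have p_odd : odd p.
  by case/even_prime: (p_prime) => // p2; case/negP: pM; rewrite p2.
have d1_unit : d1 \is a GRing.unit by apply: to_Rhat_unit => //; apply: inP1.
(* Gauge invariance of d enters here, giving one constant [w] in A for both indices. *)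
have sigd i : sigR i d1 = to_Rhat _ d.
  have [_ sigRE] := sigRP i; rewrite sigRE ?inP1 //; congr to_Rhat.
  by move: i {sigRE}; apply: ord2_ind; rewrite ?sigma1 ?gal_id.
have lifts i : exists psi : {rmorphism coord_ring_hat P1 -> coord_ring_hat P1}, _ :=
  let: And4 sK sVK scst sx := sigGP i in
  conjugate_lift sK sVK sx (etrans (scst d1) (congr1 _ (sigd i))) (conn i).1
    (metric_scalar (met i)).
have [psi1 [psi1E lift1 met1 chr1]] := lifts ord0.
have [psi2 [psi2E lift2 met2 chr2]] := lifts ord_max.
have [phi1 phi1E] := p_derivation_lift (conn ord0).1.
pose s : seq (coord_ring_hat P1) := [:: p%:R; x_hat P1 ord0 ord0 - 1;
  x_hat P1 ord_max ord_max - 1; x_hat P1 ord0 ord_max; x_hat P1 ord_max ord0].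
pose red : {rmorphism coord_ring_hat P1 -> quot_ring s} := quot_pi s.
have red_gen i : (i < size s)%N -> red s`_i = 0 := @quot_pi_gen _ s i.
have red_p : red p%:R = 0 := red_gen 0%N isT.
have red_x i l : red (x_hat P1 i l) = (i == l)%:R.
  move: i l; apply: ord2_ind; apply: ord2_ind => /=.
  - apply/eqP; rewrite -subr_eq0 -(rmorph1 red) -rmorphB; apply/eqP.
    exact: (red_gen 1%N isT).
  - exact: (red_gen 3%N isT).
  - exact: (red_gen 4%N isT).
  - apply/eqP; rewrite -subr_eq0 -(rmorph1 red) -rmorphB; apply/eqP.
    exact: (red_gen 2%N isT).
have [b [c d1E]] := to_Rhat_pth_power P1 p_prime discF discM pM dM.
set w := cst_hat d1.
have wE : w = cst_hat b ^+ p + p%:R * cst_hat c.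
  by rewrite /w /d1 d1E rmorphD rmorphM rmorphXn rmorph_nat.
pose t := red (cst_hat (deltaR ord0 d1 / d1 ^+ p)).
have tf := @coord_ring_hat_torsion_free F p P1 p_prime.
suff H : red (phi ord0 ord_max (x_hat P1 j k)) = mx2 0 (t ^+ p) (- t ^+ p) 0 j k.
  rewrite [Phi12 j k]mxE.
  have redE : red (mx2 0 e (- e) 0 j k) = mx2 0 (t ^+ p) (- t ^+ p) 0 j k.
    rewrite [mx2 0 e _ _ _ _]mxE [RHS]mxE /e.
    by do 2 case: ifP => _; rewrite ?(rmorph0 red) ?(rmorphN red) ?(rmorphXn red).
  apply: (iffLR (@quot_piE _ s _ _)).
  exact: etrans H (esym redE).
apply: (@curvature_mod _ _ p_prime tf _ red (x_hat P1) red_p red_x psi1 psi2 _ _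
  w _ _ (red (cst_hat d1^-1)) t p_odd lift1 lift2 wE _ _ met1 met2).
- by rewrite -!rmorphM divrr ?rmorph1.
(* There is no need to identify the conjugation by sigma_1 with the identity: psi_1 and phi^1 are
   lifts on the same ring, so D_1 w and delta^1 w agree mod p. *)
- have lift_phi1 : lift_with p (delta ord0) phi1 by move=> f; rewrite phi1E.
  have [r ->] := lift_unique_mod tf lift1 lift_phi1 wE.
  rewrite rmorphD rmorphM red_p mul0r addr0.
  have -> : delta ord0 w = cst_hat (deltaR ord0 d1) := (conn ord0).2 d1.
  rewrite /t /w -(rmorphXn red) -(rmorphM red) -(rmorphXn (@cst_hat F p P1)).
  by rewrite -(rmorphM (@cst_hat F p P1)) divrK ?unitrX.
- move=> l; rewrite -chr1 -chr2.
  have c1 := christoffel_scalar d (conn ord0).1 ord_max l.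
  have c2 := christoffel_scalar d (conn ord_max).1 ord0 l.
  apply: etrans (congr1 (sigGV ord_max) c2); apply: etrans (tor ord0 ord_max l).
  exact: esym (congr1 (sigGV ord0) c1).
- by rewrite !psi1E !psi2E; apply: phiP.
Qed.
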